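(* Let $p$ be a prime, let $\lambda_1\geq\lambda_2\geq 1$ be integers and let $G_{\lambda}=\mathbb{Z}_{p^{\lambda_1}}\times\mathbb{Z}_{p^{\lambda_2}}$. Then $$|\mathcal{E}_{p^i}(G_{\lambda})| = \begin{cases} \dfrac{p^{i+1}+p^i-2}{p-1}, & 1\leq i\leq\lambda_2,\\[2mm] \dfrac{p^{\lambda_2+1}-1}{p-1}, & \lambda_2<i\leq\lambda_1. \end{cases}$$
   Context: $\mathbb{Z}_n$ denotes the cyclic group of order $n$. For a finite abelian group $G$ and a positive integer $d$, $\mathcal{E}_d(G)=\{H\leq G : \exp(H)=d\}$ is the set of subgroups of $G$ whose exponent is exactly $d$. *)

(* Defs.v *)
From mathcomp Require Import all_boot all_order all_algebra all_fingroup all_solvable.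

Set Implicit Arguments.
Unset Strict Implicit.
Unset Printing Implicit Defensive.

Definition subgroups_of_exponent (gT : finGroupType) (G : {group gT}) (d : nat)
    : {set {group gT}} :=
  [set H : {group gT} | (H \subset G) && (exponent H == d)].

(* The group law on 'Z_n is addition.  'Z_n is the cyclic group of order n only
   for n > 1, so this has the intended meaning when p is prime and
   l1, l2 >= 1. *)
Definition G_lambda (p l1 l2 : nat)
    : {group ('Z_(p ^ l1) * 'Z_(p ^ l2))%type} :=
  [set: 'Z_(p ^ l1) * 'Z_(p ^ l2)]%G.

(* Main.v *)
Require Import Defs.
From mathcomp Require Import all_boot all_order all_algebra all_fingroup all_solvable.
From mathcomp Require Import zify.

(** Write N(a, b, i) for the number of subgroups of exponent p^i in a group
    G = <x> x <y> with x of order p^a, y of order p^b and b <= a.  The count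
    satisfies a recursion that lowers a, b and i together.

    Cyclic subgroups.  A cyclic group of order p^i has totient(p^i) generators,
    so the cyclic subgroups of exponent p^i number
    #{z in G : z has order p^i} / totient(p^i) ([card_cyclic_subgroups]).  The
    elements killed by p^k form 'Ohm_k(G), of order p^(min(a,k) + min(b,k)),
    and subtracting two successive orders gives p^i + p^(i-1) cyclic subgroups
    if 1 <= i <= b, and p^b of them if b < i <= a.

    Noncyclic subgroups.  For a, b >= 1 the kernel 'Ohm_1(G) of the map
    f : z |-> z^p has rank 2, as G has, and a subgroup H is noncyclic exactly
    when it contains that kernel ([noncyclic_Ohm1]).  By the correspondence
    theorem for f, noncyclic subgroups of exponent p^i match the subgroups of
    exponent p^(i-1) of f(G) = 'Mho^1(G) ([card_noncyclic_subgroups]), and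
    'Mho^1(G) = <x^p> x <y^p> is again of the same shape.  Hence
    N(a, b, i) = #cyclic + N(a-1, b-1, i-1).

    If i <= b the recursion stops at i = 0, where the trivial group is the only
    one counted, and N = 1 + sum_(1 <= k <= i) (p^k + p^(k-1)).  If b < i <= a
    it stops at b = 0, where G is cyclic, and N = 1 + p + ... + p^b.  Summing
    the geometric series gives the two formulas. *)

Import Order.TTheory GRing.Theory Num.Theory.

Section Counting.
Set Implicit Arguments.
Unset Strict Implicit.
Unset Printing Implicit Defensive.
Local Open Scope group_scope.
Local Open Scope nat_scope.

(** * Cyclic subgroups and generators *)

(** Sort the elements of order n by the cyclic group that they generate: each
    class is the set of generators of a cyclic group of order n, and for a
    cyclic group the order is the exponent. *)
Lemma card_cyclic_subgroups (gT : finGroupType) (G : {group gT}) (n : nat) :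
  #|[set H in subgroups_of_exponent G n | cyclic H]| * totient n
    = #|[set x in G | #[x]%g == n]|.
Proof.
set S := [set H in _ | _]; rewrite -[RHS]sum1_card.
rewrite (partition_big (fun x => <[x]>%G) (mem S)) /=; last first.
  move=> x; rewrite !inE => /andP[Gx /eqP <-].
  by rewrite cycle_subG Gx exponent_cycle eqxx cycle_cyclic.
rewrite -sum_nat_const; apply: eq_bigr => H.
rewrite !inE => /andP[/andP[sHG /eqP eH] /cyclicP[a defH]].
rewrite sum1dep_card -eH defH exponent_cycle totient_gen.
apply: eq_card => x; rewrite !inE.
apply/idP/andP=> [gen_x | [_ /eqP/(congr1 val) /= xH]].
  have xH : <[x]>%g = <[a]>%g by rewrite -(eqP gen_x).
  rewrite -cycle_subG xH -defH sHG orderE xH -orderE -exponent_cycle.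
  rewrite -defH eH eqxx.
  by split=> //; apply/eqP/val_inj; rewrite /= xH.
by rewrite /generator -defH -xH.
Qed.

(** * Noncyclic subgroups and the p-th power map *)

Lemma abelian_expgM (gT : finGroupType) (G : {group gT}) (n : nat) :
  abelian G -> {in G &, {morph (fun x => x ^+ n)%g : x y / (x * y)%g}}.
Proof. by move=> cGG x y Gx Gy; rewrite expgMn //; apply: (centsP cGG). Qed.

Section PowerMap.

Variables (gT : finGroupType) (G : {group gT}) (p : nat).
Hypotheses (p_pr : prime p) (pG : p.-group G) (cGG : abelian G).

(** The factor is exactly p because a nontrivial p-group has exponent divisible
    by p; the trivial group has to be excluded, its exponent staying 1. *)
Lemma exponent_Mho1 (H : {group gT}) :
  H \subset G -> H :!=: 1%g -> exponent H = p * exponent 'Mho^1(H).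
Proof.
move=> sHG ntH; have pH := pgroupS sHG pG.
have MhoH : 'Mho^1(H) = [set x ^+ p | x in H]%g.
  by rewrite (MhoEabelian _ pH) ?(abelianS sHG).
have [q def_e] : exists q, exponent H = p * q.
  have /p_natP[e def_e] : p.-nat (exponent H) by rewrite pnat_exponent.
  case: e def_e => [|e] def_e; last by exists (p ^ e); rewrite def_e expnS.
  by case/negP: ntH; rewrite trivg_exponent def_e.
apply/eqP; rewrite eqn_dvd; apply/andP; split.
  apply/exponentP=> x Hx; rewrite expgM.
  by apply: (exponentP (dvdnn _)); rewrite MhoH; apply: imset_f.
rewrite def_e dvdn_pmul2l ?prime_gt0 //.
apply/exponentP=> _ /[!MhoH] /imsetP[x Hx ->].
by rewrite -expgM -def_e expg_exponent.
Qed.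

(** An abelian p-group H has rank log_p #|'Ohm_1(H)| and is cyclic exactly when
    that rank is at most 1.  As 'Ohm_1(H) lies in 'Ohm_1(G), of order p^2, rank
    at least 2 forces the two to coincide. *)
Lemma noncyclic_Ohm1 (H : {group gT}) :
    #|'Ohm_1(G)| = p ^ 2 -> H \subset G ->
  ~~ cyclic H = ('Ohm_1(G) \subset H).
Proof.
move=> oOhm sHG; have pH := pgroupS sHG pG; have cHH := abelianS sHG cGG.
rewrite abelian_rank1_cyclic // -ltnNge (rank_abelian_pgroup pH) //.
have sOhm : 'Ohm_1(H) \subset 'Ohm_1(G) by apply: OhmS.
apply/idP/idP=> [rH | sOH].
  suff <- : 'Ohm_1(H) = 'Ohm_1(G) by apply: Ohm_sub.
  apply/eqP; rewrite eqEcard sOhm oOhm.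
  have pO : p.-group 'Ohm_1(H) by apply: pgroupS pH; apply: Ohm_sub.
  by rewrite (card_pgroup pO) leq_exp2l //; apply: prime_gt1.
have : logn p #|'Ohm_1(G)| <= logn p #|'Ohm_1(H)|.
  rewrite dvdn_leq_log ?cardG_gt0 // cardSg //.
  by have := OhmS 1 sOH; rewrite Ohm_id.
by rewrite oOhm pfactorK.
Qed.

(** The correspondence theorem for the p-th power map, whose image is 'Mho^1(G)
    and whose kernel is 'Ohm_1(G): the subgroups that contain the kernel are the
    noncyclic ones, and passing to the image divides the exponent by p. *)
Lemma card_noncyclic_subgroups (k : nat) :
    #|'Ohm_1(G)| = p ^ 2 ->
  #|[set H in subgroups_of_exponent G (p ^ k.+1) | ~~ cyclic H]|
    = #|subgroups_of_exponent 'Mho^1(G) (p ^ k)|.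
Proof.
move=> oOhm; pose f := Morphism (abelian_expgM p cGG).
have imf (H : {group gT}) : H \subset G -> f @* H = 'Mho^1(H).
  move=> sHG; rewrite (MhoEabelian _ (pgroupS sHG pG)) ?(abelianS sHG) //.
  by rewrite morphimEsub.
have kerf : 'ker f = 'Ohm_1(G).
  rewrite (OhmEabelian pG) ?(abelianS (Ohm_sub 1 G)) //.
  by apply/setP=> x; rewrite !inE.
have exp_im (H : {group gT}) : H \subset G -> 'Ohm_1(G) \subset H ->
  (exponent H == p ^ k.+1) = (exponent (f @* H) == p ^ k).
  move=> sHG sOH; rewrite (exponent_Mho1 sHG) ?imf //.
    by rewrite expnS eqn_pmul2l ?prime_gt0.
  (* H contains the kernel, of order p^2, so H is nontrivial. *)
  apply: contraL sOH => /eqP->; apply/negP=> /subset_leq_card.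
  by rewrite oOhm cards1 leqNgt -(expn0 p) ltn_exp2l ?prime_gt1.
rewrite -(card_in_imset (f := fun H : {group gT} => (f @* H)%G)); last first.
  move=> H K; rewrite !inE => /andP[/andP[sHG _] ncH] /andP[/andP[sKG _] ncK].
  move/(congr1 val) => /= eqf; apply: val_inj => /=.
  rewrite (noncyclic_Ohm1 oOhm) -?kerf // in ncH.
  rewrite (noncyclic_Ohm1 oOhm) -?kerf // in ncK.
  by apply: (@morphim_inj _ _ _ f); rewrite ?inE ?ncH ?ncK ?sHG ?sKG.
apply: eq_card => K; apply/imsetP/idP=> [[H] | ].
  rewrite !inE => /andP[/andP[sHG eH] ncH] ->; rewrite /= -exp_im //.
    by rewrite -imf ?morphimS.
  by rewrite -(noncyclic_Ohm1 oOhm).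
rewrite inE /= -imf // => /andP[sKM eK].
have sOP : 'Ohm_1(G) \subset f @*^-1 K by rewrite -kerf ker_sub_pre.
have sPG : f @*^-1 K \subset G by apply: subsetIl.
have imP : f @* (f @*^-1 K) = K by rewrite morphpreK.
exists (f @*^-1 K)%G; last by apply: val_inj; rewrite /= imP.
by rewrite !inE (noncyclic_Ohm1 oOhm) // sPG sOP exp_im //= imP eK.
Qed.

End PowerMap.

(** * Products of two cyclic p-groups *)

Lemma card_Ohm_cycle (gT : finGroupType) (x : gT) (p a k : nat) :
  prime p -> #[x]%g = p ^ a -> #|'Ohm_k(<[x]>)| = p ^ minn a k.
Proof.
move=> p_pr ox; have px : p.-elt x by rewrite /p_elt ox pnatX pnat_id.
rewrite (Ohm_p_cycle _ px) -orderE ox pfactorK //.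
rewrite (orderXexp _ ox); congr (_ ^ _); lia.
Qed.

Section TwoCyclicFactors.

Variables (gT : finGroupType) (G : {group gT}) (x y : gT) (p a b : nat).
Hypotheses (p_pr : prime p) (defG : <[x]> \x <[y]> = G).
Hypotheses (ox : #[x]%g = p ^ a) (oy : #[y]%g = p ^ b).

Lemma dprod_cycles_pgroup : p.-group G.
Proof.
by rewrite /pgroup -(dprod_card defG) -!orderE ox oy pnatM !pnatX pnat_id.
Qed.

Lemma dprod_cycles_abelian : abelian G.
Proof.
case/dprodP: defG => _ <- cxy _.
by rewrite abelianM !cycle_abelian.
Qed.

Lemma card_Ohm_dprod_cycles (k : nat) :
  #|'Ohm_k(G)| = p ^ (minn a k + minn b k).
Proof.
rewrite -(dprod_card (Ohm_dprod k defG)).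
by rewrite (card_Ohm_cycle _ p_pr ox) (card_Ohm_cycle _ p_pr oy) expnD.
Qed.

(** The elements of order p^(k+1) are those of 'Ohm_(k+1)(G) outside
    'Ohm_k(G). *)
Lemma card_order_dprod_cycles (k : nat) :
  #|[set z in G | #[z]%g == p ^ k.+1]| + p ^ (minn a k + minn b k)
    = p ^ (minn a k.+1 + minn b k.+1).
Proof.
rewrite -!card_Ohm_dprod_cycles.
have OhmG j : 'Ohm_j(G) = 'Ldiv_(p ^ j)(G).
  rewrite (OhmEabelian dprod_cycles_pgroup) // (abelianS (Ohm_sub _ _)) //.
  exact: dprod_cycles_abelian.
rewrite addnC -(cardsID 'Ohm_k(G) 'Ohm_k.+1(G)); congr (_ + _).
  by rewrite (setIidPr _) ?Ohm_leq.
apply: eq_card => z; rewrite !OhmG !inE -!order_dvdn.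
case: (z \in G) => //=; apply/eqP/andP=> [-> | []].
  by rewrite dvdn_Pexp2l ?prime_gt1 // ltnn.
move=> ndv /(dvdn_pfactor _ _ p_pr)[m le_m oz]; move: ndv.
rewrite oz dvdn_Pexp2l ?prime_gt1 // -ltnNge => lt_km.
by congr (_ ^ _); lia.
Qed.

(** For k < b the preceding counts give p^(2k+2) - p^(2k) elements of order
    p^(k+1), that is (p - 1) p^k (p^(k+1) + p^k). *)
Lemma card_cyclic_small_exponent (k : nat) : k < b -> b <= a ->
  #|[set H in subgroups_of_exponent G (p ^ k.+1) | cyclic H]|
    = p ^ k.+1 + p ^ k.
Proof.
move=> lt_kb le_ba; have p_gt1 := prime_gt1 p_pr.
have := card_order_dprod_cycles k.
rewrite -card_cyclic_subgroups totient_pfactor //=.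
have -> : minn a k + minn b k = k + k by lia.
have -> : minn a k.+1 + minn b k.+1 = k.+1 + k.+1 by lia.
set c := #|_|; rewrite !expnD !expnS; have : 0 < p ^ k by rewrite expn_gt0; lia.
(* Writing p = r + 1 turns totient (p^(k+1)) into r * q without subtraction. *)
move: (p ^ k) => q q_gt0; case: p p_gt1 => [|r] //= r_gt1 E.
have : (r * q) * c = (r * q) * (r.+1 * q + q) by lia.
by move/eqP; rewrite eqn_pmul2l ?muln_gt0 ?q_gt0 ?andbT // => /eqP.
Qed.

(** For b <= k < a only the first factor still grows: there are
    p^(k+1+b) - p^(k+b) = (p - 1) p^k p^b elements of order p^(k+1). *)
Lemma card_cyclic_large_exponent (k : nat) : b <= k -> k < a ->
  #|[set H in subgroups_of_exponent G (p ^ k.+1) | cyclic H]| = p ^ b.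
Proof.
move=> le_bk lt_ka; have p_gt1 := prime_gt1 p_pr.
have := card_order_dprod_cycles k.
rewrite -card_cyclic_subgroups totient_pfactor //=.
have -> : minn a k + minn b k = k + b by lia.
have -> : minn a k.+1 + minn b k.+1 = k.+1 + b by lia.
set c := #|_|; rewrite !expnD !expnS; have : 0 < p ^ k by rewrite expn_gt0; lia.
(* Writing p = r + 1 turns totient (p^(k+1)) into r * q without subtraction. *)
move: (p ^ k) => q q_gt0; case: p p_gt1 => [|r] //= r_gt1 E.
have : (r * q) * c = (r * q) * (r.+1 ^ b) by lia.
by move/eqP; rewrite eqn_pmul2l ?muln_gt0 ?q_gt0 ?andbT // => /eqP.
Qed.

Lemma card_subgroups_split (k : nat) : 0 < a -> 0 < b ->
  #|subgroups_of_exponent G (p ^ k.+1)|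
    = #|[set H in subgroups_of_exponent G (p ^ k.+1) | cyclic H]|
      + #|subgroups_of_exponent 'Mho^1(G) (p ^ k)|.
Proof.
move=> a_gt0 b_gt0.
rewrite -(card_noncyclic_subgroups p_pr dprod_cycles_pgroup dprod_cycles_abelian).
  rewrite -(cardsID [set H : {group gT} | cyclic H]); congr (_ + _).
    by apply: eq_card => H; rewrite !inE.
  by apply: eq_card => H; rewrite !inE andbC.
by rewrite card_Ohm_dprod_cycles; congr (_ ^ _); lia.
Qed.

(** The p-th powers form a group of the same shape with both orders divided by
    p, so that the recursion applies to it. *)
Lemma Mho1_dprod_cycles : 0 < a -> 0 < b ->
  [/\ <[x ^+ p]> \x <[y ^+ p]> = 'Mho^1(G),
      #[x ^+ p]%g = p ^ a.-1 & #[y ^+ p]%g = p ^ b.-1].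
Proof.
move=> a_gt0 b_gt0.
have pelt (z : gT) c : #[z]%g = p ^ c -> p.-elt z.
  by move=> oz; rewrite /p_elt oz pnatX pnat_id.
split.
- rewrite -(Mho_dprod 1 defG).
  by rewrite (Mho_p_cycle 1 (pelt x a ox)) (Mho_p_cycle 1 (pelt y b oy)).
- by rewrite -[X in x ^+ X]expn1 (orderXexp _ ox) subn1.
by rewrite -[X in y ^+ X]expn1 (orderXexp _ oy) subn1.
Qed.

End TwoCyclicFactors.

(** * Solving the recursion *)

(** Stated without division, so that the induction stays in the natural
    numbers.  The base case i = 0 counts the trivial group alone. *)
Lemma card_subgroups_small_exponent (p i : nat) (gT : finGroupType)
    (G : {group gT}) (x y : gT) (a b : nat) :
    prime p -> <[x]> \x <[y]> = G -> #[x]%g = p ^ a -> #[y]%g = p ^ b ->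
    i <= b -> b <= a ->
  #|subgroups_of_exponent G (p ^ i)| * p.-1 + 2 = p ^ i.+1 + p ^ i.
Proof.
move=> p_pr; have p_gt0 := prime_gt0 p_pr.
elim: i G x y a b => [|k IH] G x y a b defG ox oy le_ib le_ba.
  rewrite (_ : subgroups_of_exponent _ _ = [set 1%G]) ?cards1.
    by rewrite expn1 expn0; lia.
  apply/setP=> H; rewrite !inE -dvdn1 -trivg_exponent.
  apply/andP/eqP=> [[_ /eqP H1] | ->]; last by rewrite sub1G.
  exact: val_inj.
have [a_gt0 b_gt0] : 0 < a /\ 0 < b by lia.
have [defM ox' oy'] := Mho1_dprod_cycles p_pr defG ox oy a_gt0 b_gt0.
rewrite (card_subgroups_split p_pr defG ox oy) //.
rewrite (card_cyclic_small_exponent p_pr defG ox oy) //.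
have : #|subgroups_of_exponent 'Mho^1(G) (p ^ k)| * p.-1 + 2 = p ^ k.+1 + p ^ k.
  by apply: (IH _ _ _ _ _ defM ox' oy'); lia.
rewrite mulnDl !expnS; case: (p) p_gt0 => // r _ /=; lia.
Qed.

(** Induction on b: since i > b, the second factor is exhausted first.  When
    b = 0 the group is cyclic and every subgroup is covered by
    [card_cyclic_large_exponent]. *)
Lemma card_subgroups_large_exponent (p i : nat) (gT : finGroupType)
    (G : {group gT}) (x y : gT) (a b : nat) :
    prime p -> <[x]> \x <[y]> = G -> #[x]%g = p ^ a -> #[y]%g = p ^ b ->
    b < i -> i <= a ->
  #|subgroups_of_exponent G (p ^ i)| * p.-1 + 1 = p ^ b.+1.
Proof.
move=> p_pr; have p_gt0 := prime_gt0 p_pr.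
elim: b i G x y a => [|b IH] [|k] G x y a // defG ox oy lt_bi le_ia.
  have cycG : cyclic G.
    have y1 : y = 1%g by apply/eqP; rewrite -order_eq1 oy.
    by move: defG; rewrite y1 cycle1 dprodg1 => <-; apply: cycle_cyclic.
  rewrite expn1 -(eq_card (A :=
      [set H in subgroups_of_exponent G (p ^ k.+1) | cyclic H])).
    by rewrite (card_cyclic_large_exponent p_pr defG ox oy) //; lia.
  move=> H; rewrite !inE; case: (boolP (H \subset G)) => //= sHG.
  by rewrite (cyclicS sHG cycG) andbT.
have a_gt0 : 0 < a by lia.
have [defM ox' oy'] := Mho1_dprod_cycles p_pr defG ox oy a_gt0 isT.
rewrite (card_subgroups_split p_pr defG ox oy) //.
rewrite (card_cyclic_large_exponent p_pr defG ox oy) //.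
have : #|subgroups_of_exponent 'Mho^1(G) (p ^ k)| * p.-1 + 1 = p ^ b.+1.
  by apply: (IH _ _ _ _ _ defM ox' oy'); lia.
rewrite mulnDl (expnS p b.+1); case: (p) p_gt0 => // r _ /=; lia.
Qed.

(** * The group of the statement *)

Lemma order_Zp_gen (n : nat) : 1 < n -> #[Zp1 : 'Z_n]%g = n.
Proof. by move=> n_gt1; rewrite order_Zp1 Zp_cast. Qed.

Lemma G_lambda_dprod (p l1 l2 : nat) : prime p -> 0 < l1 -> 0 < l2 ->
  exists x y : 'Z_(p ^ l1) * 'Z_(p ^ l2),
    [/\ <[x]> \x <[y]> = G_lambda p l1 l2, #[x]%g = p ^ l1 & #[y]%g = p ^ l2].
Proof.
move=> p_pr l1_gt0 l2_gt0.
have gt1 l : 0 < l -> 1 < p ^ l.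
  by move=> l_gt0; rewrite -(exp1n l) ltn_exp2r ?prime_gt1.
exists (pairg1 _ (Zp1 : 'Z_(p ^ l1))), (pair1g _ (Zp1 : 'Z_(p ^ l2))); split.
- rewrite -!morphim_cycle ?inE // -!Zp_cycle.
  rewrite morphim_pairg1 morphim_pair1g setX_dprod.
  by apply/setP=> u; rewrite !inE.
- by rewrite order_injm ?injm_pairg1 ?inE // order_Zp_gen ?gt1.
by rewrite order_injm ?injm_pair1g ?inE // order_Zp_gen ?gt1.
Qed.

End Counting.

Local Open Scope ring_scope.

Theorem proposition2p1 (p l1 l2 i : nat) (p_prime : prime p)
    (l2_ge1 : (1 <= l2)%N) (l2_le_l1 : (l2 <= l1)%N) :
  ((1 <= i <= l2)%N ->
     #|subgroups_of_exponent (G_lambda p l1 l2) (p ^ i)%N|%:R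
     = (p%:R ^+ i.+1 + p%:R ^+ i - 2) / (p%:R - 1) :> rat) /\
  ((l2 < i <= l1)%N ->
     #|subgroups_of_exponent (G_lambda p l1 l2) (p ^ i)%N|%:R
     = (p%:R ^+ l2.+1 - 1) / (p%:R - 1) :> rat).
Proof.
have l1_gt0 : (0 < l1)%N := leq_trans l2_ge1 l2_le_l1.
have [x [y [defG ox oy]]] := G_lambda_dprod p_prime l1_gt0 l2_ge1.
have p_gt1 := prime_gt1 p_prime.
have p1_neq0 : p%:R - 1 != 0 :> rat by rewrite subr_eq0 pnatr_eq1 gtn_eqF.
have p1E : p.-1%:R = p%:R - 1 :> rat by rewrite -subn1 natrB // ltnW.
split=> /andP[i_gt le_i]; apply: (canRL (mulfK p1_neq0)).
  rewrite -p1E -!natrX -natrM -natrD.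
  have <- := card_subgroups_small_exponent p_prime defG ox oy le_i l2_le_l1.
  by rewrite natrD addrK.
rewrite -p1E -!natrX -natrM.
have <- := card_subgroups_large_exponent p_prime defG ox oy i_gt le_i.
by rewrite natrD addrK.
Qed.
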